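(* Let $q\in\mathbb C$ with $0<|q|<1$. Let $r,s\in\mathbb N_0\cup\{-1\}$, $u,v\in\mathbb N_0$, and $p,\ell\in\mathbb Z$ with $p\ge r-u$ and $\ell\ge s-v$. Let $\mathbf a=(a_1,\dots,a_{r+1})$, $\mathbf b=(b_1,\dots,b_u)$, $\mathbf c=(c_1,\dots,c_{s+1})$, $\mathbf d=(d_1,\dots,d_v)$ be tuples of nonzero complex numbers, and let $X,Y\in\mathbb C$ be such that the product ${}_{r+1}\phi_u^{p}(\mathbf a;\mathbf b;q,X)\,{}_{s+1}\phi_v^{\ell}(\mathbf c;\mathbf d;q,Y)$ is well defined: no $b_i$ or $d_j$ lies in $\Omega_q$, $|X|<1$ if $u-r+p=0$, and $|Y|<1$ if $v-s+\ell=0$. (1) If moreover $X\neq0$ and no $a_i$ lies in $\Omega_q$, then $${}_{r+1}\phi_u^{p}\left(\mathbf a;\mathbf b;q,X\right)\,{}_{s+1}\phi_v^{\ell}\left(\mathbf c;\mathbf d;q,Y\right)=\sum_{n=0}^\infty\frac{(\mathbf a;q)_n X^n}{(q,\mathbf b;q)_n}\left((-1)^nq^{\binom n2}\right)^{u-r+p}\;{}_{s+u+2}\phi_{r+v+1}^{\,u-r+p+\ell}\left(q^{-n},\mathbf c,\frac{q^{1-n}}{\mathbf b};\ \mathbf d,\frac{q^{1-n}}{\mathbf a};\ q,\frac{q^{1+p(1-n)}b_1\cdots b_u Y}{a_1\cdots a_{r+1}X}\right).$$ (2) If moreover $Y\neq0$ and no $c_i$ lies in $\Omega_q$, then $${}_{r+1}\phi_u^{p}\left(\mathbf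 a;\mathbf b;q,X\right)\,{}_{s+1}\phi_v^{\ell}\left(\mathbf c;\mathbf d;q,Y\right)=\sum_{n=0}^\infty\frac{(\mathbf c;q)_n Y^n}{(q,\mathbf d;q)_n}\left((-1)^nq^{\binom n2}\right)^{v-s+\ell}\;{}_{r+v+2}\phi_{s+u+1}^{\,v-s+p+\ell}\left(q^{-n},\mathbf a,\frac{q^{1-n}}{\mathbf d};\ \mathbf b,\frac{q^{1-n}}{\mathbf c};\ q,\frac{q^{1+\ell(1-n)}d_1\cdots d_v X}{c_1\cdots c_{s+1}Y}\right).$$
   Context: $\mathbb N_0=\{0,1,2,\dots\}$ and $\Omega_q=\{q^{-k}:k\in\mathbb N_0\}$. For $n\in\mathbb N_0$, $(a;q)_n=\prod_{j=0}^{n-1}(1-aq^j)$; for several entries (or tuples) $(a_1,\dots,a_k;q)_n=\prod_i(a_i;q)_n$. For a tuple $\mathbf b=(b_1,\dots,b_u)$, $q^{1-n}/\mathbf b$ denotes the tuple $(q^{1-n}/b_1,\dots,q^{1-n}/b_u)$. Empty products are $1$. Also $\binom k2=k(k-1)/2$. For $m\in\mathbb Z$ and tuples $\mathbf A=(A_1,\dots,A_R)$, $\mathbf B=(B_1,\dots,B_S)$, the van de Bult--Rains notation is $${}_R\phi_S^{m}(\mathbf A;\mathbf B;q,z)=\sum_{k=0}^\infty\frac{(\mathbf A;q)_k}{(q,\mathbf B;q)_k}\left((-1)^kq^{\binom k2}\right)^{1+S-R+m}z^k,$$ that is, the basic hypergeometric series ${}_R\phi_S$ with $m$ additional zero denominator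 parameters if $m\ge0$, and with $-m$ additional zero numerator parameters if $m<0$. A series with a numerator parameter $q^{-n}$, $n\in\mathbb N_0$, is summed over $0\le k\le n$. *)

(* Defs.v *)
From mathcomp Require Import all_boot all_order all_algebra.
From mathcomp Require Import complex.
From mathcomp Require Import all_classical all_reals all_analysis.

Set Implicit Arguments.
Unset Strict Implicit.
Unset Printing Implicit Defensive.

Import Order.TTheory GRing.Theory Num.Theory.
Import numFieldNormedType.Exports.

Local Open Scope classical_set_scope.
Local Open Scope ring_scope.
Local Open Scope complex_scope.

(* R[i] itself carries no topology in the libraries.  Packaged as a
   numClosedFieldType it gets the generic one of numFieldNormedType, that is,
   the one defined by the modulus. *)
Definition Cplx (R : realType) : numClosedFieldType := R[i].

Section BasicHypergeometric.
Variable R : realType.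
Implicit Types (q a z : Cplx R) (A B : seq (Cplx R)) (m : int) (n k : nat).

Definition qpoch q a n : Cplx R := \prod_(j < n) (1 - a * q ^+ j).

Definition qpochs q A n : Cplx R := \prod_(a <- A) qpoch q a n.

Definition in_Omega q a : Prop := exists k, a = q ^- k.

Definition qsign q n : Cplx R := (-1) ^+ n * q ^+ 'C(n, 2).

(* Here R and S are the lengths of A and B; the exponent 1 + S - R + m may be
   negative. *)
Definition phi_term q m A B z k : Cplx R :=
  qpochs q A k / qpochs q (q :: B) k
  * qsign q k ^ (1 + (size B)%:Z - (size A)%:Z + m) * z ^+ k.

Definition phi q m A B z : Cplx R := limn (series (phi_term q m A B z)).

(* The series with numerator parameters q^-n, A, summed over 0 <= k <= n.
   The cutoff is explicit because factors of (B; q)_k may vanish for k > n. *)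
Definition phi_trunc q n m A B z : Cplx R :=
  \sum_(k < n.+1) phi_term q m (q ^- n :: A) B z k.

Definition qshift_inv q n B : seq (Cplx R) := [seq q ^ (1 - n%:Z) / b | b <- B].

End BasicHypergeometric.

(* Main.v *)
Require Import Defs.
From mathcomp Require Import all_boot all_order all_algebra.
From mathcomp Require Import complex.
From mathcomp Require Import all_classical all_reals all_analysis.
From mathcomp Require Import ring lra zify.

Set Implicit Arguments.
Unset Strict Implicit.
Unset Printing Implicit Defensive.

Import Order.TTheory GRing.Theory Num.Theory.
Import numFieldNormedType.Exports.

Local Open Scope classical_set_scope.
Local Open Scope ring_scope.

(** The right-hand side is the Cauchy product of the two series on the left.

    Let f and g be the general terms of the two factors.  Reversing a
    q-shifted factorial ([qpoch_rev], [qpochs_rev]) gives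
      (x; q)_(n-k) (q^(1-n) / x; q)_k x^k = (x; q)_n t,
      t = (-1)^k q^binom(k,2) q^((1-n) k),
    with the same factor t for every x, and the sign factor reverses by t as
    well ([qsign_rev]).  So in f(n-k) the powers of t coming from the
    numerator, from the denominator, from (q; q)_(n-k) and from the sign
    factor collect to t^p, and f(n-k) = f(n) h_n(k), where h_n(k) is the
    contribution of q^-n, q^(1-n)/b and q^(1-n)/a to the inner terminating
    series ([phi_term_rev]).  Hence the n-th term of the right-hand side is
    the sum of f(n-k) g(k) over k <= n.

    Both factors converge absolutely by the ratio test ([phi_abs_cvg]): the
    quotient of consecutive terms tends to z if the exponent of the sign
    factor is 0 and to 0 if it is positive.  The Cauchy product of absolutely
    convergent series converges to the product of the sums
    ([cvg_cauchy_product]).  The second identity is the first one with the two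
    factors exchanged. *)

(** * Limits and Cauchy products *)

(** Exchanging the two sums: for fixed k the inner index m - k runs over
    [0, n - k). *)
Lemma series_convE (K : pzRingType) (f g : nat -> K) n :
  \sum_(0 <= m < n) \sum_(k < m.+1) f (m - k)%N * g k =
  \sum_(0 <= k < n) (\sum_(0 <= i < n - k) f i) * g k.
Proof.
under eq_big_nat => m /andP[_ ltmn].
  rewrite (_ : \sum_(k < m.+1) _ =
    \sum_(0 <= k < n | (k <= m)%N) f (m - k)%N * g k); last first.
    rewrite -(big_mkord predT (fun k => f (m - k)%N * g k)).
    by rewrite (big_nat_widen _ _ _ predT _ ltmn) //=; apply: eq_bigl => k; rewrite ltnS.
  over.
rewrite (exchange_big_dep_nat predT) //=; apply: eq_big_nat => k /andP[_ ltkn].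
rewrite mulr_suml; transitivity (\sum_(k <= m < n) f (m - k)%N * g k).
  by rewrite (@big_nat_widenl _ _ _ k 0%N).
rewrite -{1}(add0n k) big_addn; apply: eq_bigr => i _.
by rewrite addnK.
Qed.

Lemma le_series (K : numFieldType) (F : nat -> K) m n :
  (forall i, 0 <= F i) -> (m <= n)%N -> series F m <= series F n.
Proof.
move=> F0 mn; rewrite -subr_ge0 sub_series_geq //.
by apply: sumr_ge0.
Qed.

Lemma cvg_half (T : topologicalType) (u : nat -> T) (l : T) :
  u @ \oo --> l -> (fun n => u n./2) @ \oo --> l.
Proof.
move=> ul; apply: (cvg_comp _ _ _ ul).
apply/cvgnyPge => A; near=> n.
have : (A.*2 <= n)%N by near: n; exact: nbhs_infty_ge.
by move/half_leq; rewrite doubleK.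
Unshelve. all: by end_near. Qed.

Lemma cvg_dominated (K : numFieldType) (u : nat -> K) (l : K) (e : nat -> K) :
  (forall n, `|u n - l| <= e n) -> e @ \oo --> (0 : K) -> u @ \oo --> l.
Proof.
move=> ue e0; apply/cvgrPdist_lt => eps eps0.
move/cvgrPdist_lt : e0 => /(_ _ eps0); apply: filterS => n.
rewrite sub0r normrN distrC ger0_norm; last exact: le_trans (ue n).
exact: le_lt_trans.
Qed.

Lemma cvg_prod_seq (K : numFieldType) (u : nat -> K) (A : seq K) : u @ \oo --> (0 : K) ->
  (fun n => \prod_(x <- A) (1 - x * u n)) @ \oo --> (1 : K).
Proof.
move=> u0; elim: A => [|x A ih].
  by under eq_fun do rewrite big_nil; exact: cvg_cst.
under eq_fun do rewrite big_cons.
suff : (fun n => (1 - x * u n) * \prod_(y <- A) (1 - y * u n)) @ \oo --> (1 - x * 0) * 1.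
  by rewrite mulr0 subr0 mulr1.
apply: cvgM => //; apply: cvgB; first exact: cvg_cst.
exact: cvgMl_tmp.
Qed.

Lemma cvg_expN0 (K : numFieldType) (u : nat -> K) (e : nat) : u @ \oo --> (0 : K) ->
  (fun n => (- u n) ^+ e) @ \oo --> ((e == 0%N)%:R : K).
Proof.
move=> u0; elim: e => [|k ih]; first by under eq_fun do rewrite expr0; exact: cvg_cst.
under eq_fun do rewrite exprS.
suff : (fun n => - u n * (- u n) ^+ k) @ \oo --> - 0 * ((k == 0%N)%:R : K).
  by rewrite oppr0 mul0r.
by apply: cvgM => //; exact: cvgN.
Qed.

(** With S_n, F_n, G_n the partial sums of f, |f|, |g|, and c the convolution,
    the difference between S_n(f) S_n(g) and S_n(c) is the sum of
    (S_n(f) - S_(n-k)(f)) g(k) over k < n.  In absolute value it is at most the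
    same expression for |f| and |g|, that is, the sum of |f(i)| |g(j)| over the
    part of the square [0, n)^2 where n <= i + j.  This part misses the square
    of side n/2, which leaves the bound F_n G_n - F_(n/2) G_(n/2). *)
Lemma cvg_cauchy_product (K : numFieldType) (f g : nat -> K) (lf lg lF lG : K) :
  series f @ \oo --> lf -> series g @ \oo --> lg ->
  series (fun n => `|f n|) @ \oo --> lF -> series (fun n => `|g n|) @ \oo --> lG ->
  series (fun n => \sum_(k < n.+1) f (n - k)%N * g k) @ \oo --> lf * lg.
Proof.
move=> cf cg cF cG.
set F := series (fun n => `|f n|) in cF; set G := series (fun n => `|g n|) in cG.
have c0 : (fun n => F n * G n - F n./2 * G n./2) @ \oo --> (0 : K).
  rewrite -(subrr (lF * lG)); apply: cvgB; first exact: cvgM.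
  by apply: cvgM; apply: cvg_half.
have cprod : (fun n => series f n * series g n) @ \oo --> lf * lg by exact: cvgM.
set c := fun n => \sum_(k < n.+1) f (n - k)%N * g k.
suff h : (fun n => series c n - series f n * series g n) @ \oo --> (0 : K).
  have -> : series c = fun n => (series c n - series f n * series g n) + series f n * series g n.
    by apply/funext => n; rewrite subrK.
  by rewrite -[lf * lg]add0r; apply: cvgD.
apply: (cvg_dominated _ c0) => n; rewrite subr0 distrC.
rewrite /series /= /c series_convE mulr_sumr -sumrB.
apply: le_trans (ler_norm_sum _ _ _) _.
apply: (@le_trans _ _ (\sum_(0 <= k < n) (F n - F (n - k)%N) * `|g k|)).
  rewrite [leLHS]big_nat [leRHS]big_nat; apply: ler_sum => k /andP[_ kn].
  rewrite -mulrBl normrM ler_wpM2r//.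
  have := @sub_series_geq _ f _ _ (leq_subr k n); rewrite /series /= => ->.
  rewrite /F sub_series_geq ?leq_subr//; exact: ler_norm_sum.
under eq_bigr do rewrite mulrBl.
rewrite sumrB -mulr_sumr lerD2l lerN2.
have hn : (n./2 <= n)%N by lia.
rewrite [G n./2]/G /series /= mulr_sumr [leRHS](big_cat_nat (n:=n./2)) //=.
apply: ler_wpDr; first by apply: sumr_ge0 => k _; rewrite mulr_ge0//; apply: sumr_ge0.
rewrite [leLHS]big_nat [leRHS]big_nat; apply: ler_sum => k /andP[_ kn].
rewrite ler_wpM2r//; apply: le_series; [by []|lia].
Qed.

(** * Complex series *)

Section ComplexSeries.
Local Open Scope complex_scope.
Local Notation Re := complex.Re.
Local Notation Im := complex.Im.
Variable R : realType.

Lemma normCE (x : Cplx R) : `|x| = (ComplexField.Normc.normc x)%:C.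
Proof. by []. Qed.

(** The values are typed in [Cplx R] and not in [R[i]], so that convergence
    statements find the topology given by the modulus. *)
Definition realC (x : R) : Cplx R := x%:C.
Definition imagC : Cplx R := 'i%C.

Lemma realCE (x : Cplx R) : x = realC (Re x) + imagC * realC (Im x).
Proof. exact: complexE. Qed.

Lemma cvg_realC (u : nat -> R) (l : R) :
  u @ \oo --> l -> (fun n => realC (u n)) @ \oo --> realC l.
Proof.
move=> ul; apply/cvgrPdist_lt => e e0.
have /andP[/eqP ime ree] : (Im e == 0) && (0 < Re e).
  by move: e0; rewrite ltcE.
have -> : e = realC (Re e) by apply/eqP; rewrite eq_complex /= ime !eqxx.
move/cvgrPdist_lt : ul => /(_ _ ree); apply: filterS => n h.
by rewrite /realC -rmorphB/= normc_def/= expr0n addr0 sqrtr_sqr ltcR.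
Qed.

Lemma cvg_ReIm (f : nat -> Cplx R) (x y : R) :
  (fun n => Re (f n)) @ \oo --> x -> (fun n => Im (f n)) @ \oo --> y ->
  f @ \oo --> realC x + imagC * realC y.
Proof.
move=> cx cy; have -> : f = fun n => realC (Re (f n)) + imagC * realC (Im (f n)).
  by apply/funext => n; exact: realCE.
apply: cvgD; first exact: cvg_realC.
by apply: cvgMl_tmp; exact: cvg_realC.
Qed.

Lemma Re_sum (I : Type) (s : seq I) (P : pred I) (F : I -> Cplx R) :
  Re (\sum_(i <- s | P i) F i) = \sum_(i <- s | P i) Re (F i).
Proof. exact: (big_morph (@Re R) (fun x y => raddfD (@Re R) x y) erefl). Qed.

Lemma Im_sum (I : Type) (s : seq I) (P : pred I) (F : I -> Cplx R) :
  Im (\sum_(i <- s | P i) F i) = \sum_(i <- s | P i) Im (F i).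
Proof. exact: (big_morph (@Im R) (fun x y => raddfD (@Im R) x y) erefl). Qed.

Lemma Re_norm_ge0 (x : Cplx R) : 0 <= Re `|x|.
Proof. by move: (normr_ge0 x); rewrite lecE => /andP[]. Qed.

(** The real and imaginary parts are dominated by the modulus, so both converge
    absolutely, by completeness of the real line. *)
Lemma cvg_series_abs (f : nat -> Cplx R) :
  cvgn (series (fun n => Re `|f n|)) ->
  cvgn (series f) /\ cvgn (series (fun n => `|f n|)).
Proof.
move=> cf; split.
  have cre (h : Cplx R -> R) : (forall x, `|h x| <= Re `|x|) ->
      cvgn (series (fun n => h (f n))).
    move=> hh; apply: normed_cvg.
    apply: (@series_le_cvg R (fun n => `|h (f n)|) (fun n => Re `|f n|)) => // n.
    exact: Re_norm_ge0.
  have /cre c1 : forall x : Cplx R, `|Re x| <= Re `|x|.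
    by move=> x; rewrite -lecR; exact: normc_ge_Re.
  have /cre c2 : forall x : Cplx R, `|Im x| <= Re `|x|.
    move=> x; rewrite normc_def/= -sqrtr_sqr ler_sqrt ?addr_ge0 ?sqr_ge0//.
    by rewrite lerDr sqr_ge0.
  apply: cvgP; apply: cvg_ReIm.
    by under eq_fun do rewrite /series /= Re_sum; exact: c1.
  by under eq_fun do rewrite /series /= Im_sum; exact: c2.
suff -> : series (fun n => `|f n|) = fun n => realC (series (fun n => Re `|f n|) n).
  exact: cvgP (cvg_realC cf).
apply/funext => n; rewrite /series /=.
rewrite (big_morph realC (fun x y => rmorphD (real_complex R) x y) erefl).
by apply: eq_bigr.
Qed.

(** The ratio test, with the recurrence in place of a quotient: terms may
    vanish, as they do when a numerator parameter lies in Omega_q. *)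
Lemma ratio_test (f w : nat -> Cplx R) (L : Cplx R) :
  (forall n, f n.+1 = w n * f n) -> w @ \oo --> L -> `|L| < 1 ->
  cvgn (series f) /\ cvgn (series (fun n => `|f n|)).
Proof.
move=> fw wL L1; apply: cvg_series_abs.
(* the midpoint of |L| and 1 *)
pose rho := (Re `|L| + 1) / 2.
have L1' : Re `|L| < 1 by move: L1; rewrite normCE ltcR.
have L0 := Re_norm_ge0 L.
have [N _ hN] : \forall n \near \oo, Re `|w n| <= rho.
  (* once w n is within half the gap 1 - |L| of L, its modulus is below rho *)
  have e0 : 0 < ((1 - Re `|L|) / 2)%:C :> Cplx R by rewrite ltcR; lra.
  move/cvgrPdist_lt : wL => /(_ _ e0); apply: filterS => n.
  rewrite distrC => hn; have := ler_normD (w n - L) L; rewrite subrK.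
  move: hn; rewrite !normCE -rmorphD lecR ltcR /rho /=; lra.
have hf k : Re `|f (N + k)%N| <= Re `|f N| * rho ^+ k.
  elim: k => [|k ih]; first by rewrite addn0 expr0 mulr1.
  rewrite addnS fw normrM !normCE -rmorphM /= exprS mulrCA.
  apply: ler_pM => //.
  - by have := normr_ge0 (w (N + k)%N); rewrite normCE ler0c.
  - by have := normr_ge0 (f (N + k)%N); rewrite normCE ler0c.
  - by apply: (hN (N + k)%N) => /=; exact: leq_addr.
have : cvgn (series (geometric (Re `|f N|) rho)).
  by apply: is_cvg_geometric_series; rewrite ger0_norm /rho; lra.
move=> cg; have : cvgn (series (fun k => Re `|f (N + k)%N|)).
  apply: series_le_cvg cg => // k; first exact: Re_norm_ge0.
  by rewrite /geometric /= mulr_ge0// ?Re_norm_ge0// exprn_ge0// /rho; lra.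
move=> /cvg_ex[l hl]; apply/cvg_ex.
(* back from the tail to the whole series *)
exists (series (fun n => Re `|f n|) N + l); rewrite -(cvg_shiftn N).
have -> : (fun n => series (fun n => Re `|f n|) (n + N)%N) =
    (fun n => series (fun n => Re `|f n|) N + series (fun k => Re `|f (N + k)%N|) n).
  apply/funext => n; rewrite /series /= (@big_cat_nat _ _ _ N 0)//= ?leq_addl//.
  congr (_ + _); rewrite -{1}(add0n N) big_addn addnK.
  by apply: eq_bigr => i _; rewrite addnC.
by apply: cvgD => //; exact: cvg_cst.
Qed.

Lemma cvg_expr0 (z : Cplx R) : `|z| < 1 -> (fun n => z ^+ n) @ \oo --> (0 : Cplx R).
Proof.
move=> z1; apply: (@cvg_dominated _ _ _ (fun n => realC (Re `|z| ^+ n))).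
  by move=> n; rewrite subr0 normrX /realC rmorphXn.
rewrite -[0]/(realC 0); apply: cvg_realC; apply: cvg_expr.
rewrite ger0_norm ?Re_norm_ge0//.
by move: z1; rewrite normCE ltcR.
Qed.

End ComplexSeries.

(** * Reversal of q-shifted factorials *)

Section BasicHypergeometricSeries.
Variable R : realType.
Implicit Types (q x z : Cplx R) (A B : seq (Cplx R)).

Lemma qsign_neq0 q n : q != 0 -> qsign q n != 0.
Proof. by move=> q0; rewrite /qsign mulf_neq0 ?signr_eq0// expf_neq0. Qed.

Lemma qpochs_cons q x A n : qpochs q (x :: A) n = qpoch q x n * qpochs q A n.
Proof. exact: big_cons. Qed.

Lemma qpochs_cat q A B n : qpochs q (A ++ B) n = qpochs q A n * qpochs q B n.
Proof. exact: big_cat. Qed.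

(** The factor t by which a q-shifted factorial is multiplied on reversal; it
    depends neither on the parameter nor on how many parameters there are. *)
Definition revfac q n k : Cplx R := qsign q k * (q ^ (1 - n%:Z)) ^+ k.

Lemma revfacS q n k : q != 0 -> (k < n)%N ->
  revfac q n k * - q ^- (n - k.+1)%N = revfac q n k.+1.
Proof.
move=> q0 kn; rewrite /revfac /qsign binS bin1 !exprS exprD.
have -> : q ^- (n - k.+1)%N = q ^ (1 - n%:Z) * q ^+ k.
  rewrite (exprnP q k) -expfzDr// exprnN; congr (_ ^ _); lia.
ring.
Qed.

(** Each step k -> k + 1 trades the last factor 1 - x q^(n-k-1) of the first
    symbol for 1 - q^(k+1-n) / x, which is the same up to - x q^(n-k-1). *)
Lemma qpoch_rev q x n k : q != 0 -> x != 0 -> (k <= n)%N ->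
  qpoch q x (n - k) * qpoch q (q ^ (1 - n%:Z) / x) k * x ^+ k
  = qpoch q x n * revfac q n k.
Proof.
move=> q0 x0; elim: k => [|k ih] kn.
  by rewrite subn0 /qpoch big_ord0 /revfac /qsign bin0n !expr0 !mulr1.
rewrite -(revfacS q0 kn) mulrA -ih ?(ltnW kn)//.
rewrite -(subnSK kn) /qpoch !big_ord_recr /=.
have -> : q ^ (1 - n%:Z) = q ^- (n - k.+1)%N / q ^+ k.
  rewrite -[LHS]mulr1 -(mulfV (expf_neq0 k q0)) mulrA; congr (_ / _).
  rewrite (exprnP q k) -expfzDr// exprnN; congr (_ ^ _); lia.
rewrite exprS.
have qk0 := expf_neq0 k q0; have qnk0 := expf_neq0 (n - k.+1) q0.
by field; rewrite ?qk0 ?qnk0 ?x0.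
Qed.

Lemma qsign_rev q n k : q != 0 -> (k <= n)%N ->
  qsign q (n - k) = qsign q n * revfac q n k.
Proof.
move=> q0; elim: k => [|k ih] kn.
  by rewrite subn0 /revfac /qsign bin0n !expr0 !mulr1.
rewrite -(revfacS q0 kn) mulrA -ih ?(ltnW kn)// -(subnSK kn).
rewrite /qsign binS bin1 exprS exprD.
have h := expf_neq0 (n - k.+1) q0.
by field.
Qed.

Lemma qpochs_rev q A n k : q != 0 -> (forall x, x \in A -> x != 0) -> (k <= n)%N ->
  qpochs q A (n - k) * qpochs q (qshift_inv q n A) k * (\prod_(x <- A) x) ^+ k
  = qpochs q A n * revfac q n k ^+ size A.
Proof.
move=> q0 + kn; rewrite /qpochs /qshift_inv big_map.
elim: A => [|x A ih] hA; first by rewrite !big_nil expr1n !mulr1.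
have x0 : x != 0 by rewrite hA ?mem_head.
rewrite !big_cons /= exprS exprMn [RHS]mulrACA -(qpoch_rev q0 x0 kn).
rewrite -ih; last by move=> y yA; rewrite hA// in_cons yA orbT.
ring.
Qed.

Lemma revfac_neq0 q n k : q != 0 -> revfac q n k != 0.
Proof.
by move=> q0; rewrite /revfac /qsign !(mulf_neq0, expf_neq0)// ?signr_eq0// expfz_neq0.
Qed.

Lemma qpoch_neq0 q x n : q != 0 -> ~ in_Omega q x -> qpoch q x n != 0.
Proof.
move=> q0 xO; apply/prodf_neq0 => j _; apply/eqP => /eqP.
rewrite subr_eq0 => /eqP h; apply: xO; exists j.
by apply: (mulIf (expf_neq0 j q0)); rewrite -h mulVf// expf_neq0.
Qed.

Lemma qpochs_neq0 q A n : q != 0 -> (forall x, x \in A -> ~ in_Omega q x) ->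
  qpochs q A n != 0.
Proof.
move=> q0 hA; rewrite /qpochs prodf_seq_neq0; apply/allP => x xA /=.
by apply: qpoch_neq0 => //; exact: hA.
Qed.

(** No positive power of q is 1, so q itself is not in Omega_q. *)
Lemma qpoch_q_neq0 q n : q != 0 -> `|q| < 1 -> qpoch q q n != 0.
Proof.
move=> q0 q1; apply: qpoch_neq0 => // -[k qk].
have : q ^+ k.+1 = 1 by rewrite exprS {1}qk mulVf// expf_neq0.
move/(congr1 Num.norm); rewrite normrX normr1 => /eqP.
by rewrite pexpr_eq1// lt_eqF.
Qed.

(** The numerator parameter q^-n of the inner series comes from (q; q)_n: it is
    the shifted inverse of the parameter q. *)
Lemma shift_inv_q q (n : nat) : q != 0 -> q ^ (1 - n%:Z) / q = q ^- n.
Proof.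
by move=> q0; rewrite expfzDr// expr1z -exprnN mulrAC mulfV// mul1r.
Qed.

Lemma qpoch_qN_neq0 q n k : q != 0 -> `|q| < 1 -> (k <= n)%N -> qpoch q (q ^- n) k != 0.
Proof.
move=> q0 q1 kn; have := qpoch_rev q0 q0 kn.
rewrite shift_inv_q// => e; apply/eqP => z; move: e; rewrite z mulr0 mul0r => /esym/eqP.
by rewrite mulf_eq0 (negPf (qpoch_q_neq0 n q0 q1)) (negPf (revfac_neq0 _ _ q0)).
Qed.

Lemma qpochs_inv_neq0 q A n k : q != 0 ->
  (forall x, x \in A -> x != 0) -> (forall x, x \in A -> ~ in_Omega q x) -> (k <= n)%N ->
  qpochs q (qshift_inv q n A) k != 0.
Proof.
move=> q0 A0 hA kn; have := qpochs_rev q0 A0 kn => e.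
apply/eqP => z; move: e; rewrite z mulr0 mul0r => /esym/eqP.
by rewrite mulf_eq0 (negPf (qpochs_neq0 n q0 hA)) (negPf (expf_neq0 _ (revfac_neq0 _ _ q0))).
Qed.

(** The powers of t add up: size A from the numerator, - 1 - size B from the
    denominator and 1 + size B - size A + m from the sign factor leave t^m,
    which up to q^k is the sign factor and the power of q^(1-n) on the right. *)
Lemma phi_term_rev q m A B z n k : q != 0 -> `|q| < 1 ->
  (forall x, x \in A -> x != 0) -> (forall x, x \in B -> x != 0) ->
  (forall x, x \in A -> ~ in_Omega q x) -> (forall x, x \in B -> ~ in_Omega q x) ->
  z != 0 -> (k <= n)%N ->
  phi_term q m A B z (n - k) =
  phi_term q m A B z n *
   (qpoch q (q ^- n) k * qpochs q (qshift_inv q n B) k / qpochs q (qshift_inv q n A) k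
    * qsign q k ^ m * (q ^ (1 + m * (1 - n%:Z)) * (\prod_(x <- B) x)
           / ((\prod_(x <- A) x) * z)) ^+ k).
Proof.
move=> q0 q1 A0 B0 AO BO z0 kn.
have t0 := revfac_neq0 n k q0; set t := revfac q n k in t0.
have a0 := qpochs_inv_neq0 q0 A0 AO kn; have b0 := qpochs_inv_neq0 q0 B0 BO kn.
have qn0 := qpoch_qN_neq0 q0 q1 kn.
have pA0 : \prod_(x <- A) x != 0 by rewrite prodf_seq_neq0; apply/allP => x /A0.
have pB0 : \prod_(x <- B) x != 0 by rewrite prodf_seq_neq0; apply/allP => x /B0.
have eA : qpochs q A (n - k) = qpochs q A n * t ^+ size A
    / (qpochs q (qshift_inv q n A) k * (\prod_(x <- A) x) ^+ k).
  rewrite -(qpochs_rev q0 A0 kn) -(mulrA (qpochs q A (n - k))) mulfK//.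
  by rewrite mulf_neq0// expf_neq0.
have eB : qpochs q B (n - k) = qpochs q B n * t ^+ size B
    / (qpochs q (qshift_inv q n B) k * (\prod_(x <- B) x) ^+ k).
  rewrite -(qpochs_rev q0 B0 kn) -(mulrA (qpochs q B (n - k))) mulfK//.
  by rewrite mulf_neq0// expf_neq0.
have eq : qpoch q q (n - k) = qpoch q q n * t / (qpoch q (q ^- n) k * q ^+ k).
  rewrite -(qpoch_rev q0 q0 kn) shift_inv_q//.
  by rewrite -(mulrA (qpoch q q (n - k))) mulfK// mulf_neq0// expf_neq0.
have ez : z ^+ (n - k) = z ^+ n / z ^+ k by rewrite expfB_cond// (negPf z0).
have et : qsign q k ^ m * (q ^ (1 + m * (1 - n%:Z))) ^+ k = t ^ m * q ^+ k.
  rewrite expfzDr// expr1z exprMn mulrCA mulrC; congr (_ * _).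
  rewrite /t /revfac [RHS]expfzMl; congr (_ * _).
  by rewrite !exprnP !exprz_exp; congr (_ ^ _); ring.
have em : t ^ (1 + (size B)%:Z - (size A)%:Z + m) = t * t ^+ size B / t ^+ size A * t ^ m.
  by rewrite !expfzDr// expr1z exprnN.
rewrite /phi_term !qpochs_cons eA eB eq ez (qsign_rev q0 kn) -/t expfzMl em.
have {et} -> : t ^ m = qsign q k ^ m * (q ^ (1 + m * (1 - n%:Z))) ^+ k / q ^+ k.
  by rewrite et mulfK// expf_neq0.
rewrite !(exprMn k) (exprVn _ k) !(exprMn k).
have qb0 := qpochs_neq0 n q0 BO; have qq0 := qpoch_q_neq0 n q0 q1.
have pAk := expf_neq0 k pA0; have pBk := expf_neq0 k pB0; have zk := expf_neq0 k z0.
have qk := expf_neq0 k q0; have tA := expf_neq0 (size A) t0; have tB := expf_neq0 (size B) t0.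
(* t has to be atomic for the field tactic *)
clear eA eB eq ez em; clearbody t.
move: (qsign q n ^ _) (qsign q k ^ m) => s1 s2.
field.
by do ?[apply/andP; split].
Qed.

(** * Absolute convergence *)

Lemma qpochsS q A n :
  qpochs q A n.+1 = qpochs q A n * \prod_(x <- A) (1 - x * q ^+ n).
Proof.
by rewrite /qpochs -big_split /=; apply: eq_bigr => x _; rewrite /qpoch big_ord_recr.
Qed.

Lemma qsignS q n : qsign q n.+1 = qsign q n * - q ^+ n.
Proof. by rewrite /qsign binS bin1 exprS exprD; ring. Qed.

Lemma phi_termS q m A B z (e : nat) n : 1 + (size B)%:Z - (size A)%:Z + m = e ->
  phi_term q m A B z n.+1 =
  (\prod_(x <- A) (1 - x * q ^+ n) / \prod_(x <- q :: B) (1 - x * q ^+ n)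
    * (- q ^+ n) ^+ e * z) * phi_term q m A B z n.
Proof.
move=> he; rewrite /phi_term he !qpochsS qsignS expfzMl invfM exprSr -!exprnP.
ring.
Qed.

(** All factors 1 - x q^n of the ratio tend to 1, so the ratio tends to z 0^e,
    where e is the exponent of the sign factor and 0^0 = 1. *)
Lemma phi_abs_cvg q m A B z : `|q| < 1 ->
  0 <= 1 + (size B)%:Z - (size A)%:Z + m ->
  (1 + (size B)%:Z - (size A)%:Z + m = 0 -> `|z| < 1) ->
  cvgn (series (phi_term q m A B z)) /\
  cvgn (series (fun n => `|phi_term q m A B z n|)).
Proof.
move=> q1; case eE : (1 + _ - _ + m) => [e|//] _ hz.
have qn := cvg_expr0 q1.
have cw : (fun n => \prod_(x <- A) (1 - x * q ^+ n) / \prod_(x <- q :: B) (1 - x * q ^+ n)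
    * (- q ^+ n) ^+ e * z) @ \oo --> 1 / 1 * (e == 0%N)%:R * z.
  apply: cvgMr_tmp; apply: cvgM; last exact: cvg_expN0.
  apply: cvgM; first exact: cvg_prod_seq.
  by apply: cvgV; [exact: oner_neq0|exact: cvg_prod_seq].
apply: (ratio_test (fun n => phi_termS q z n eE) cw).
rewrite divr1 mul1r; case: (e) hz => [hz|k _]; first by rewrite mul1r; exact: hz.
by rewrite mul0r normr0.
Qed.

(** * The product formula *)

(** The exponents e and e' are variables tied by equations, because they are
    u - r + p and v - s + l in terms of the lengths of the tuples. *)
Lemma phi_product_cvg q p l (a b c d : seq (Cplx R)) X Y (e e' : int) : q != 0 -> `|q| < 1 ->
  (forall x, x \in a -> x != 0) -> (forall x, x \in b -> x != 0) ->
  (forall x, x \in a -> ~ in_Omega q x) -> (forall x, x \in b -> ~ in_Omega q x) ->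
  X != 0 ->
  1 + (size b)%:Z - (size a)%:Z + p = e ->
  1 + (size d)%:Z - (size c)%:Z + l = e' ->
  0 <= e -> 0 <= e' -> (e = 0 -> `|X| < 1) -> (e' = 0 -> `|Y| < 1) ->
  series (fun n : nat =>
      qpochs q a n * X ^+ n / qpochs q (q :: b) n
      * qsign q n ^ e
      * phi_trunc q n (e + l)
          (c ++ qshift_inv q n b) (d ++ qshift_inv q n a)
          (q ^ (1 + p * (1 - n%:Z)) * (\prod_(x <- b) x) * Y
           / ((\prod_(x <- a) x) * X))) @ \oo
    --> phi q p a b X * phi q l c d Y.
Proof.
move=> q0 q1 a0 b0 aO bO X0 eE eE' e_ge0 e'_ge0 hX hY.
have [cf /cvg_ex[F cF]] := @phi_abs_cvg q p a b X q1 ltac:(by rewrite eE) ltac:(by rewrite eE).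
have [cg /cvg_ex[G cG]] := @phi_abs_cvg q l c d Y q1 ltac:(by rewrite eE') ltac:(by rewrite eE').
have := cvg_cauchy_product cf cg cF cG.
rewrite (_ : (fun n => \sum_(k < n.+1) _) = (fun n : nat =>
      qpochs q a n * X ^+ n / qpochs q (q :: b) n
      * qsign q n ^ e
      * phi_trunc q n (e + l)
          (c ++ qshift_inv q n b) (d ++ qshift_inv q n a)
          (q ^ (1 + p * (1 - n%:Z)) * (\prod_(x <- b) x) * Y
           / ((\prod_(x <- a) x) * X))))//.
apply/funext => n; rewrite /phi_trunc mulr_sumr; apply: eq_bigr => -[k /= kn] _.
rewrite phi_term_rev// -(mulrA (phi_term q p a b X n)).
congr (_ * _); first by rewrite /phi_term eE; ring.
rewrite [RHS]/phi_term.
have -> : 1 + (size (d ++ qshift_inv q n a))%:Z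
    - (size (q ^- n :: c ++ qshift_inv q n b))%:Z + (e + l) = p + e'.
  by rewrite -eE -eE' /qshift_inv /= !size_cat !size_map; lia.
rewrite (expfzDr p e' (qsign_neq0 k q0)) /phi_term eE' !qpochs_cons !qpochs_cat !invfM.
rewrite (mulrAC _ Y) (exprMn k _ Y).
ring.
Qed.

End BasicHypergeometricSeries.

Theorem theorem5p1 (R : realType) (q : Cplx R) (hq0 : 0 < `|q|) (hq1 : `|q| < 1)
    (r s : int) (hr : -1 <= r) (hs : -1 <= s) (u v : nat)
    (p l : int) (hp : r - u%:Z <= p) (hl : s - v%:Z <= l)
    (a : (absz (r + 1)).-tuple (Cplx R)) (b : u.-tuple (Cplx R))
    (c : (absz (s + 1)).-tuple (Cplx R)) (d : v.-tuple (Cplx R))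
    (ha : forall x, x \in a -> x != 0) (hb : forall x, x \in b -> x != 0)
    (hc : forall x, x \in c -> x != 0) (hd : forall x, x \in d -> x != 0)
    (X Y : Cplx R)
    (hbO : forall x, x \in b -> ~ in_Omega q x)
    (hdO : forall x, x \in d -> ~ in_Omega q x)
    (hX : u%:Z - r + p = 0 -> `|X| < 1)
    (hY : v%:Z - s + l = 0 -> `|Y| < 1) :
  (X != 0 -> (forall x, x \in a -> ~ in_Omega q x) ->
    series (fun n : nat =>
      qpochs q a n * X ^+ n / qpochs q (q :: b) n
      * qsign q n ^ (u%:Z - r + p)
      * phi_trunc q n (u%:Z - r + p + l)
          (c ++ qshift_inv q n b) (d ++ qshift_inv q n a)
          (q ^ (1 + p * (1 - n%:Z)) * (\prod_(x <- b) x) * Y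
           / ((\prod_(x <- a) x) * X))) @ \oo
    --> phi q p a b X * phi q l c d Y)
  /\
  (Y != 0 -> (forall x, x \in c -> ~ in_Omega q x) ->
    series (fun n : nat =>
      qpochs q c n * Y ^+ n / qpochs q (q :: d) n
      * qsign q n ^ (v%:Z - s + l)
      * phi_trunc q n (v%:Z - s + p + l)
          (a ++ qshift_inv q n d) (b ++ qshift_inv q n c)
          (q ^ (1 + l * (1 - n%:Z)) * (\prod_(x <- d) x) * X
           / ((\prod_(x <- c) x) * Y))) @ \oo
    --> phi q p a b X * phi q l c d Y).
Proof.
have q0 : q != 0 by rewrite -normr_gt0.
(* the tuples a and c have r + 1 and s + 1 entries *)
have sz (t m : int) (w : nat) : -1 <= t ->
    1 + w%:Z - (absz (t + 1))%:Z + m = w%:Z - t + m by lia.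
split=> [X0 aO|Y0 cO].
  apply: phi_product_cvg => //; rewrite ?size_tuple ?sz//; lia.
rewrite (mulrC (phi q p a b X)) (addrAC _ p l).
apply: phi_product_cvg => //; rewrite ?size_tuple ?sz//; lia.
Qed.
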